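(* Let $\pi:(M^{4n},\psi)\to B$ be a locally generalized Lagrangian-type toric fibration and let $F$ be a fiber of $\pi$. Then there exists an open neighborhood of $F$ that is fiber-preserving tetraplectomorphic to $(V\times Q^n,\psi_{\mathbb R^n\times Q^n})$, fibred by the projection $V\times Q^n\to V\subset\mathbb R^n$ onto the first factor, for some $V\subset\mathbb R^n$.
   Context: $Q=\mathrm{Sp}(1)\cong S^3$ is the group of unit quaternions. A tetraplectic structure on a real $4n$-manifold is a closed 4-form $\psi$ such that $v\mapsto\iota_v\psi$ has trivial kernel; a tetraplectomorphism is a diffeomorphism $f$ with $f^*\psi'=\psi$. On $\mathbb H^n\cong\mathbb R^{4n}$, $\psi_{\mathbb H^n}=\sum_{k=1}^n dx_{4k-3}\wedge dx_{4k-2}\wedge dx_{4k-1}\wedge dx_{4k}$, and $\pi_{\mathbb H^n}:\mathbb H^n\to\mathbb R^n_{\ge0}$ is $(h_i)\mapsto(|h_i|^4)$. On $\mathbb R^n\times Q^n$, $\psi_{\mathbb R^n\times Q^n}=\sum_{k=1}^n d\xi_k\wedge d\theta_k^1\wedge d\theta_k^2\wedge d\theta_k^3$, where $(\xi_1,\dots,\xi_n)$ are coordinates on $\mathbb R^n$ and $d\theta_k^1\wedge d\theta_k^2\wedge d\theta_k^3$ is the invariant volume form of the $k$-th copy of $S^3$ expressed in angular coordinates. Let $(M^{4n},\psi)$ be a smooth $4n$-manifold with a tetraplectic structure and $B$ an $n$-dimensional manifold with corners. A map $\pi:(M^{4n},\psi)\to B$ is a locally generalized Lagrangian-type toric fibration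 if there is a system $\{(U_\alpha^B,\varphi_\alpha^B)\}$ of coordinate neighborhoods of $B$ modeled on $\mathbb R^n_{\ge0}$ and, for each $\alpha$, a tetraplectomorphism $\varphi_\alpha^M:(\pi^{-1}(U_\alpha^B),\psi)\to(\pi_{\mathbb H^n}^{-1}(\varphi_\alpha^B(U_\alpha^B)),\psi_{\mathbb H^n})$ with $\pi_{\mathbb H^n}\circ\varphi_\alpha^M=\varphi_\alpha^B\circ\pi$. A fiber-preserving tetraplectomorphism is a tetraplectomorphism that maps fibers diffeomorphically onto fibers, covering an identification of the bases.
   Formalization: F is taken to be a fiber over an interior point of B; over a boundary point the claim is false, since the fiber is then Q^{n-j} with j ≥ 1 (e.g. F = {0} for |h|^4 on H) and cannot be mapped diffeomorphically onto Q^n. *)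

(* Defs.v *)
From HB Require Import structures.
From mathcomp Require Import all_boot all_order all_algebra.
From mathcomp Require Import all_classical all_reals all_analysis.

Set Implicit Arguments.
Unset Strict Implicit.
Unset Printing Implicit Defensive.

Import Order.TTheory GRing.Theory Num.Theory numFieldNormedType.Exports.

Local Open Scope classical_set_scope.
Local Open Scope ring_scope.

(* C^oo on an open set O: every iterated directional derivative is (Frechet)
   differentiable on O.  Only used between finite-dimensional spaces. *)
Definition smooth (R : realType) (E F : normedModType R) (O : set E)
    (f : E -> F) : Prop :=
  forall (s : seq E) (x : E), O x ->
    differentiable (foldr (fun v (g : E -> F) => ('D_v g : E -> F)) f s) x.

(* Smoothness on an arbitrary subset X of E: local smooth extendability.  This
   is the usual convention both for manifolds with corners (X relatively open
   in an orthant) and for submanifolds X of E. *)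
Definition smooth_within (R : realType) (E F : normedModType R) (X : set E)
    (f : E -> F) : Prop :=
  forall x, X x -> exists (O : set E) (g : E -> F),
    [/\ open O, O x, smooth O g & forall y, O y -> X y -> g y = f y].

(* Only the values of [cmap] on [cdom], and of [cinv] on [cmap @` cdom], are
   meaningful. *)
Record chart (T : topologicalType) (E : Type) := Chart {
  cdom : set T;
  cmap : T -> E;
  cinv : E -> T
}.

Definition cimg (T : topologicalType) (E : Type) (c : chart T E) : set E :=
  cmap c @` cdom c.

(* Homeomorphism from an open set of T onto a relatively open set of X. *)
Definition is_chart (R : realType) (E : normedModType R) (X : set E)
    (T : topologicalType) (c : chart T E) : Prop :=
  [/\ open (cdom c),
      exists2 O : set E, open O & cimg c = O `&` X,
      forall p, cdom c p -> cinv c (cmap c p) = p,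
      {within cdom c, continuous (cmap c)} &
      {within cimg c, continuous (cinv c)}].

Definition smooth_transition (R : realType) (E : normedModType R)
    (T : topologicalType) (c c' : chart T E) : Prop :=
  smooth_within (cmap c @` (cdom c `&` cdom c')) (cmap c' \o cinv c).

(* Smooth manifolds modelled on relatively open subsets of X: ordinary
   manifolds for X = setT, manifolds with corners for X an orthant. *)
Record manifold (R : realType) (E : normedModType R) (X : set E) := Manifold {
  space :> topologicalType;
  atlas : set (chart space E);
  _ : hausdorff_space space;
  _ : @second_countable space;
  _ : forall c, atlas c -> is_chart X c;
  _ : forall p, exists2 c, atlas c & cdom c p;
  _ : forall c c', atlas c -> atlas c' -> smooth_transition c c'
}.

(* Membership in the maximal atlas. *)
Definition smooth_chart (R : realType) (E : normedModType R) (X : set E)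
    (N : manifold X) (c : chart N E) : Prop :=
  is_chart X c /\
  forall c', atlas c' -> smooth_transition c c' /\ smooth_transition c' c.

(* f maps the open submanifold W of N diffeomorphically onto the submanifold S
   of the vector space F. *)
Definition diffeomorphism (R : realType) (E F : normedModType R) (X : set E)
    (N : manifold X) (W : set N) (S : set F) (f : N -> F) : Prop :=
  [/\ open W,
      set_bij W S f,
      (forall c : chart N E, atlas c ->
         smooth_within (cmap c @` (W `&` cdom c)) (f \o cinv c)) &
      exists g : F -> N,
        [/\ forall p, W p -> g (f p) = p,
            {within S, continuous g} &
            forall c : chart N E, atlas c ->
              smooth_within (S `&` g @^-1` cdom c) (cmap c \o g)]].

Definition alternating_multilinear (R : realType) (E : normedModType R)
    (k : nat) (w : ('I_k -> E) -> R) : Prop :=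
  (forall v i (a : R) (x y : E),
     w (dfwith v i (a *: x + y)) =
     a * w (dfwith v i x) + w (dfwith v i y)) /\
  (forall v i j, i != j -> v i = v j -> w v = 0).

Definition pullback (R : realType) (E F : normedModType R) (k : nat)
    (f : E -> F) (w : F -> ('I_k -> F) -> R) (x : E) (v : 'I_k -> E) : R :=
  w (f x) (fun i => 'D_(v i) f x).

(* A differential k-form, as a compatible family of local representatives:
   [w c x v] is the value at x, on k vectors v, of the form read in the chart c
   (meaningful for c in the atlas and x in the image of c). *)
Record diff_form (R : realType) (E : normedModType R) (M : manifold [set: E])
    (k : nat) := DiffForm {
  local_form :> chart M E -> E -> ('I_k -> E) -> R;
  _ : forall c x, atlas c -> cimg c x -> alternating_multilinear (local_form c x);
  _ : forall c v, atlas c -> smooth (cimg c) (fun x => local_form c x v);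
  _ : forall c c' p v, atlas c -> atlas c' -> cdom c p -> cdom c' p ->
        local_form c (cmap c p) v =
        pullback (cmap c' \o cinv c) (local_form c') (cmap c p) v
}.

Definition exterior_derivative (R : realType) (E : normedModType R) (k : nat)
    (w : E -> ('I_k -> E) -> R) (x : E) (v : 'I_k.+1 -> E) : R :=
  \sum_(i < k.+1)
    (-1) ^+ i * ('D_(v i) (fun y => w y (v \o lift i)) x : R).

Definition closed_form (R : realType) (E : normedModType R)
    (M : manifold [set: E]) (k : nat) (w : diff_form M k) : Prop :=
  forall c x v, atlas c -> cimg c x -> exterior_derivative (w c) x v = 0.

(* [cons_vec u v] is (u, v_0, ..., v_(k-1)), so that the contraction of w by u
   is [fun v => w (cons_vec u v)]. *)
Definition cons_vec (E : Type) (k : nat) (u : E) (v : 'I_k -> E)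
    (i : 'I_k.+1) : E :=
  oapp v u (unlift ord0 i).

Definition trivial_kernel (R : realType) (E : normedModType R)
    (M : manifold [set: E]) (k : nat) (w : diff_form M k.+1) : Prop :=
  forall c x u, atlas c -> cimg c x ->
    (forall v, w c x (cons_vec u v) = 0) -> u = 0.

(* The wedge product of k linear forms, with the normalization
   (a_1 /\ ... /\ a_k)(v_1, ..., v_k) = det (a_j (v_i)). *)
Definition wedge (R : realType) (E : Type) (k : nat) (a : 'I_k -> E -> R)
    (v : 'I_k -> E) : R :=
  \det (\matrix_(i < k, j < k) a j (v i)).

(* H^n = R^(4n): the k-th row holds the four real coordinates of the k-th
   quaternion (in the basis 1, i, j, k). *)
Notation Hn R n := 'M[R]_(n, 4).

Definition qconj (R : realType) (q : 'rV[R]_4) : 'rV[R]_4 :=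
  \row_(j < 4) (if j == ord0 then q 0 j else - q 0 j).

Definition qmul (R : realType) (p q : 'rV[R]_4) : 'rV[R]_4 :=
  let a j := p 0 (inord j) in
  let b j := q 0 (inord j) in
  \row_(j < 4)
    [:: a 0%N * b 0%N - a 1%N * b 1%N - a 2%N * b 2%N - a 3%N * b 3%N;
        a 0%N * b 1%N + a 1%N * b 0%N + a 2%N * b 3%N - a 3%N * b 2%N;
        a 0%N * b 2%N - a 1%N * b 3%N + a 2%N * b 0%N + a 3%N * b 1%N;
        a 0%N * b 3%N + a 1%N * b 2%N - a 2%N * b 1%N + a 3%N * b 0%N]`_j.

(* |q|^2 *)
Definition qnorm2 (R : realType) (q : 'rV[R]_4) : R :=
  \sum_(j < 4) q 0 j ^+ 2.

(* Q^n, where Q = Sp(1) is the unit sphere of the quaternions. *)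
Definition Qn (R : realType) (n : nat) : set (Hn R n) :=
  [set q | forall k, qnorm2 (row k q) = 1].

Definition orthant (R : realType) (n : nat) : set 'rV[R]_n :=
  [set x | forall k, 0 <= x 0 k].

Definition pi_H (R : realType) (n : nat) (h : Hn R n) : 'rV[R]_n :=
  \row_(k < n) (qnorm2 (row k h)) ^+ 2.

Definition psi_H (R : realType) (n : nat) (h : Hn R n)
    (v : 'I_4 -> Hn R n) : R :=
  \sum_(k < n) wedge (fun (j : 'I_4) (u : Hn R n) => u k j) v.

(* The form sum_k dxi_k /\ vol_k, evaluated at (xi, q) on vectors of the
   ambient space R^n x H^n (on R^n x Q^n, only vectors tangent to it matter).
   The invariant volume form vol_k of the k-th copy of Sp(1) is the wedge of
   the i-, j- and k-components of the left-invariant form q_k^-1 dq_k, where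
   q_k^-1 is the conjugate of the unit quaternion q_k; at q_k = 1 it is the
   standard volume form of Im H, so that it is the volume form of the round
   unit sphere. *)
Definition psi_RQ (R : realType) (n : nat) (z : 'rV[R]_n * Hn R n)
    (v : 'I_4 -> 'rV[R]_n * Hn R n) : R :=
  \sum_(k < n)
    wedge (fun (j : 'I_4) (u : 'rV[R]_n * Hn R n) =>
             if j == ord0 then u.1 0 k
             else qmul (qconj (row k z.2)) (row k u.2) 0 j) v.

(* A tetraplectic structure on a manifold M of dimension 4n. *)
Definition tetraplectic (R : realType) (n : nat)
    (M : manifold [set: Hn R n]) (psi : diff_form M 4) : Prop :=
  closed_form psi /\ trivial_kernel psi.

(* f is a tetraplectomorphism from the open submanifold W of (M, psi) onto the
   submanifold S of F, endowed with the restriction of the form w. *)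
Definition tetraplectomorphism (R : realType) (n : nat)
    (M : manifold [set: Hn R n]) (psi : diff_form M 4) (F : normedModType R)
    (W : set M) (S : set F) (w : F -> ('I_4 -> F) -> R) (f : M -> F) : Prop :=
  diffeomorphism W S f /\
  forall (c : chart M (Hn R n)) p v, atlas c -> W p -> cdom c p ->
    pullback (f \o cinv c) w (cmap c p) v = psi c (cmap c p) v.

Definition locally_toric_fibration (R : realType) (n : nat)
    (M : manifold [set: Hn R n]) (psi : diff_form M 4)
    (B : manifold (@orthant R n)) (pi : M -> B) : Prop :=
  exists (I : Type) (phiB : I -> chart B 'rV[R]_n) (phiM : I -> M -> Hn R n),
    [/\ forall a, smooth_chart (phiB a),
        forall b, exists a, cdom (phiB a) b &
        forall a,
          tetraplectomorphism psi
            (pi @^-1` cdom (phiB a)) (@pi_H R n @^-1` cimg (phiB a))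
            (@psi_H R n) (phiM a) /\
          forall p, cdom (phiB a) (pi p) ->
            pi_H (phiM a p) = cmap (phiB a) (pi p)].

Definition interior_point (R : realType) (n : nat)
    (B : manifold (@orthant R n)) (b : B) : Prop :=
  exists c : chart B 'rV[R]_n,
    [/\ smooth_chart c, cdom c b & forall k, 0 < cmap c b 0 k].

(* f is a tetraplectomorphism from the open set W onto V x Q^n which maps the
   fibers of [pi] in W onto the fibers {xi} x Q^n of the first projection, and
   covers a diffeomorphism h from pi(W) onto V.  The restriction of f to a fiber
   is a diffeomorphism because f is one. *)
Definition fiber_preserving_tetraplectomorphism (R : realType) (n : nat)
    (M : manifold [set: Hn R n]) (psi : diff_form M 4)
    (B : manifold (@orthant R n)) (pi : M -> B)
    (W : set M) (V : set 'rV[R]_n) (f : M -> 'rV[R]_n * Hn R n) : Prop :=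
  tetraplectomorphism psi W (V `*` @Qn R n) (@psi_RQ R n) f /\
  exists2 h : B -> 'rV[R]_n,
    diffeomorphism (pi @` W) V h &
    forall b, (pi @` W) b ->
      f @` (W `&` pi @^-1` [set b]) = [set h b] `*` @Qn R n.

(* Main.v *)
(* In a toric chart around the fiber the fibration is [pi_H], and over the
   interior of the orthant no quaternionic coordinate vanishes.  There polar
   coordinates h_k = r_k q_k are available, and
   dx_1 /\ dx_2 /\ dx_3 /\ dx_4 = r^3 dr /\ vol_{S^3} = d(r^4 / 4) /\ vol_{S^3},
   so h |-> (|h_k|^4 / 4, h_k / |h_k|)_k carries psi_H to psi_RQ and pi_H to four
   times the first projection.  That the base point is interior in the toric
   chart too is invariance of the boundary under smooth changes of charts: a
   coordinate of the transition map vanishing at an interior point would have a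
   minimum there, hence a zero differential, although the differential is onto. *)

Require Import Defs.
From HB Require Import structures.
From mathcomp Require Import all_boot all_order all_algebra.
From mathcomp Require Import all_classical all_reals all_analysis.
From mathcomp Require Import ring.
Set Implicit Arguments.
Unset Strict Implicit.
Unset Printing Implicit Defensive.
Import Order.TTheory GRing.Theory Num.Theory numFieldNormedType.Exports.
Local Open Scope classical_set_scope.
Local Open Scope ring_scope.

(** * Calculus of smooth maps *)

Section NearEq.
Context {R : numFieldType} {V W : normedModType R}.

(** A first-order expansion depends only on the germ at [x], so that of [f] also serves [g];
    uniqueness of the differential then transfers differentiability. *)
Lemma near_eq_diff_locally (f g : V -> W) (x : V) :
  (\near x, f x = g x) -> differentiable f x ->
  g \o shift x = cst (g x) + 'd f x +o_ 0 id.
Proof.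
move=> fg df; apply/eqaddoP => e e0.
have fgx : f x = g x by exact: nbhs_singleton fg.
have /eqaddoP/(_ _ e0) := diff_locally df.
have : \forall y \near (0 : V), f (y + x) = g (y + x).
  by move: fg; rewrite (near_shift 0) subr0.
by apply: filterS2 => y fgy; rewrite !fctE /= fgy fgx.
Qed.

Lemma near_eq_differentiable (f g : V -> W) (x : V) :
  (\near x, f x = g x) -> differentiable f x -> differentiable g x.
Proof.
move=> fg df; have gE := near_eq_diff_locally fg df.
have cdf : continuous ('d f x) by exact: diff_continuous.
by apply/diff_locallyP; rewrite (diff_unique cdf gE).
Qed.
End NearEq.

(** * Iterated directional derivatives *)

Section IteratedDerivatives.
Context {R : realType} {E : normedModType R}.

(* [smooth] applies the first direction of the list last; here the first
   derivative is taken innermost, which is what the product and chain rules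
   need.  By [smoothP] the two agree. *)
Fixpoint Ck {F : normedModType R} (k : nat) (O : set E) (f : E -> F) : Prop :=
  (forall x, O x -> differentiable f x) /\
  if k is k'.+1 then forall v, Ck k' O ('D_v f) else True.

Lemma Ck_differentiable (F : normedModType R) k O (f : E -> F) x :
  Ck k O f -> O x -> differentiable f x.
Proof. by case: k => [|k] [+ _]; apply. Qed.

Lemma Ck_succ (F : normedModType R) k O (f : E -> F) : Ck k.+1 O f -> Ck k O f.
Proof.
elim: k f => [|k IH] f [df Df]; first by split.
by split=> // v; apply: IH.
Qed.

(** [foldr] applies the last direction of the list first, so peeling the list from its end with
    [rcons] matches the recursion of [Ck]. *)
Lemma smoothP (F : normedModType R) O (f : E -> F) : smooth O f <-> forall k, Ck k O f.
Proof.
split=> [sf k|Cf s].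
  elim: k f sf => [|k IH] f sf; split => //; try exact: (sf [::]).
  by move=> v; apply: IH => s x Ox; have := sf (rcons s v) x Ox; rewrite foldr_rcons.
elim/last_ind: s f Cf => [|s v IH] f Cf x Ox; first exact: (Ck_differentiable (Cf 0) Ox).
by rewrite foldr_rcons; apply: IH => // k; have [_] := Cf k.+1; apply.
Qed.

(** On an open set equality is equality of germs at each point, hence passes to all derivatives.
    This lets the differentiation rules below, valid only on [O], replace a derivative by its
    formula. *)
Lemma eq_Ck (F : normedModType R) k O (f g : E -> F) : open O ->
  (forall x, O x -> f x = g x) -> Ck k O f -> Ck k O g.
Proof.
move=> oO; elim: k f g => [|k IH] f g fg Cf.
  split=> // x Ox; apply: near_eq_differentiable (Ck_differentiable Cf Ox).
  exact: filterS fg (open_nbhs_nbhs (conj oO Ox)).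
have fgn x : O x -> \near x, f x = g x.
  by move=> Ox; exact: filterS fg (open_nbhs_nbhs (conj oO Ox)).
split=> [x Ox|v].
  exact: near_eq_differentiable (fgn x Ox) (Ck_differentiable Cf Ox).
apply: IH (Cf.2 v) => x Ox; exact: near_eq_derive (fgn x Ox).
Qed.

Lemma Ck_cst (F : normedModType R) k O (a : F) : Ck k O (cst a).
Proof.
elim: k a => [|k IH] a; split=> //; try by move=> x Ox; apply: differentiable_cst.
move=> v; have -> : 'D_v (cst a) = cst (0 : F) by apply/funext => x; rewrite derive_cst.
exact: IH.
Qed.

Lemma Ck_linear_comp (F G : normedModType R) k O (L : {linear F -> G}) (f : E -> F) :
  open O -> continuous L -> Ck k O f -> Ck k O (L \o f).
Proof.
move=> oO cL; elim: k f => [|k IH] f Cf; have df := Ck_differentiable Cf.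
  split=> // x Ox; apply: differentiable_comp; first exact: df.
  exact: linear_differentiable.
split=> [x Ox|v].
  by apply: differentiable_comp; [exact: df|exact: linear_differentiable].
apply: (eq_Ck oO _ (IH _ (Cf.2 v))) => x Ox /=.
have dL := linear_differentiable (f x) cL; have dfx := df x Ox.
rewrite (deriveE v dfx) (deriveE v (differentiable_comp dfx dL)).
by rewrite (diff_comp dfx dL) /= (diff_lin _ cL).
Qed.

Lemma Ck_linear (F : normedModType R) k O (L : {linear E -> F}) :
  continuous L -> Ck k O L.
Proof.
move=> cL; case: k => [|k]; split=> //; try by move=> x _; exact: linear_differentiable.
move=> v; have -> : 'D_v L = cst (L v).
  apply/funext => x; rewrite (deriveE v (linear_differentiable x cL)).
  by rewrite (diff_lin _ cL).
exact: Ck_cst.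
Qed.

Lemma Ck_add (F : normedModType R) k O (f g : E -> F) :
  open O -> Ck k O f -> Ck k O g -> Ck k O (f \+ g).
Proof.
move=> oO; elim: k f g => [|k IH] f g Cf Cg; have df := Ck_differentiable Cf;
    have dg := Ck_differentiable Cg.
  by split=> // x Ox; apply: differentiableD; [exact: df|exact: dg].
split=> [x Ox|v]; first by apply: differentiableD; [exact: df|exact: dg].
apply: (eq_Ck oO _ (IH _ _ (Cf.2 v) (Cg.2 v))) => x Ox /=.
by rewrite deriveD//; apply: diff_derivable; [exact: df|exact: dg].
Qed.

Lemma Ck_sum (F : normedModType R) k O (I : Type) (r : seq I) (f : I -> E -> F) :
  open O -> (forall i, Ck k O (f i)) -> Ck k O (fun x => \sum_(i <- r) f i x).
Proof.
move=> oO Cf; elim: r => [|i r IH].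
  by rewrite (_ : (fun _ => _) = cst 0); [exact: Ck_cst|apply/funext=> x; rewrite big_nil].
rewrite (_ : (fun _ => _) = f i \+ (fun x => \sum_(i <- r) f i x)).
  exact: Ck_add.
by apply/funext=> x; rewrite big_cons.
Qed.
End IteratedDerivatives.

Section MatrixCoordinates.
Context {R : realType} {m n : nat}.

(** Named so that a linear structure can be attached to it. *)
Definition mxcoord i j (M : 'M[R]_(m, n)) : R := M i j.

Lemma mxcoord_linear i j : linear (mxcoord i j).
Proof. by move=> a u v; rewrite /mxcoord !mxE. Qed.
HB.instance Definition _ i j := GRing.isLinear.Build _ _ _ _ _ (mxcoord_linear i j).

Lemma Ck_entry k O i j : Ck k O (fun M : 'M[R]_(m, n) => M i j).
Proof. exact: (@Ck_linear _ _ _ _ _ (mxcoord i j) (@coord_continuous _ m n i j)). Qed.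

Lemma derive_entry (M v : 'M[R]_(m, n)) i j :
  'D_v (fun M : 'M[R]_(m, n) => M i j) M = v i j.
Proof.
have cc : continuous (mxcoord i j) := @coord_continuous _ m n i j.
by rewrite (deriveE v (linear_differentiable M cc)) (diff_lin M cc).
Qed.
End MatrixCoordinates.

(** * Product, power and chain rules *)

Section Operations.
Context {R : realType}.

Lemma scale_is_bilinear (F : normedModType R) : bilinear_for
  (GRing.Scale.Law.clone _ _ *:%R _) (GRing.Scale.Law.clone _ _ *:%R _)
  (@GRing.scale R F : R -> F -> F).
Proof.
split=> [u'|u] a x y /=.
- by rewrite scalerDl scalerA.
- by rewrite scalerDr !scalerA mulrC.
Qed.
HB.instance Definition _ (F : normedModType R) := bilinear_isBilinear.Build R R F F _ _
  (@GRing.scale R F : R -> F -> F) (@scale_is_bilinear F).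

(** The chain rule through the continuous bilinear map [h] precomposed with the pair (f, g). *)
Lemma differentiable_scale (E F : normedModType R) (f : E -> R) (g : E -> F) x :
  differentiable f x -> differentiable g x ->
  differentiable (fun x => f x *: g x) x /\
  forall v, 'd (fun x => f x *: g x) x v = f x *: 'd g x v + 'd f x v *: g x.
Proof.
move=> df dg.
pose h := fun q : R * F => q.1 *: q.2.
have cs : continuous h by exact: scale_continuous.
have dh := @differentiable_bilin R R F F (@GRing.scale R F : R -> F -> F) (f x, g x) cs.
have hE := @diff_bilin R R F F (@GRing.scale R F : R -> F -> F) (f x, g x) cs.
rewrite -/h in dh hE.
have dp := differentiable_pair df dg.
rewrite (_ : (fun x => _) = h \o (fun x => (f x, g x))) //.
split=> [|v]; first exact: differentiable_comp.
by rewrite diff_comp //= hE /= (diff_pair df dg).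
Qed.

Context {E : normedModType R}.

(** Each term of the Leibniz formula has one undifferentiated factor, which [Ck_succ] lowers to the
    order of the induction hypothesis. *)
Lemma Ck_scale (F : normedModType R) k O (f : E -> R) (g : E -> F) :
  open O -> Ck k O f -> Ck k O g -> Ck k O (fun x => f x *: g x).
Proof.
move=> oO; elim: k f g => [|k IH] f g Cf Cg; have df := Ck_differentiable Cf;
    have dg := Ck_differentiable Cg.
  by split=> // x Ox; apply: (differentiable_scale (df _ Ox) (dg _ Ox)).1.
split=> [x Ox|v]; first by apply: (differentiable_scale (df _ Ox) (dg _ Ox)).1.
have C1 := Ck_add oO (IH _ _ (Ck_succ Cf) (Cg.2 v)) (IH _ _ (Cf.2 v) (Ck_succ Cg)).
apply: (eq_Ck oO _ C1) => x Ox /=.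
have [dfg fgE] := differentiable_scale (df _ Ox) (dg _ Ox).
by rewrite (deriveE v dfg) (deriveE v (df x Ox)) (deriveE v (dg x Ox)).
Qed.

Lemma derive_mul (f g : E -> R) (x v : E) :
  differentiable f x -> differentiable g x ->
  'D_v (fun y => f y * g y) x = f x * 'D_v g x + 'D_v f x * g x.
Proof.
move=> df dg; have [dfg fgE] := differentiable_scale df dg.
by rewrite (deriveE v dfg) (deriveE v df) (deriveE v dg); exact: fgE.
Qed.

Lemma Ck_mul k O (f g : E -> R) :
  open O -> Ck k O f -> Ck k O g -> Ck k O (fun x => f x * g x).
Proof. exact: Ck_scale. Qed.

Lemma diff_powR (f : E -> R) a x : differentiable f x -> 0 < f x ->
  differentiable (fun x => f x `^ a) x /\
  forall v, 'd (fun x => f x `^ a) x v = a * f x `^ (a - 1) * 'd f x v.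
Proof.
move=> df f0; have [dp pE] := is_derive1_powR a f0.
have dp' : differentiable (fun y : R => y `^ a) (f x) by apply/derivable1_diffP.
rewrite (_ : (fun x => f x `^ a) = (fun y : R => y `^ a) \o f) //.
split=> [|v]; first exact: differentiable_comp.
rewrite (diff_comp df dp') /= deriv1E// derive1E pE.
exact: mulrC.
Qed.

(** Differentiation lowers the exponent by one, so the induction runs over all [a] at once. *)
Lemma Ck_powR k O (f : E -> R) a :
  open O -> (forall x, O x -> 0 < f x) -> Ck k O f -> Ck k O (fun x => f x `^ a).
Proof.
move=> oO f0; elim: k f f0 a => [|k IH] f f0 a Cf; have df := Ck_differentiable Cf.
  by split=> // x Ox; exact: (diff_powR a (df _ Ox) (f0 _ Ox)).1.
split=> [x Ox|v]; first exact: (diff_powR a (df _ Ox) (f0 _ Ox)).1.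
have C1 := Ck_mul oO (Ck_mul oO (Ck_cst k O a) (IH _ f0 (a - 1) (Ck_succ Cf))) (Cf.2 v).
apply: (eq_Ck oO _ C1) => x Ox /=.
have [dpf pfE] := diff_powR a (df _ Ox) (f0 _ Ox).
by rewrite (deriveE v dpf) (deriveE v (df x Ox)).
Qed.

Lemma Ck_coord m n k O (f : E -> 'M[R]_(m, n)) i j : open O ->
  Ck k O f -> Ck k O (fun x => f x i j).
Proof.
move=> oO; exact: (Ck_linear_comp (L := mxcoord i j) oO (@coord_continuous _ m n i j)).
Qed.

Lemma Ck_scalel (F : normedModType R) k O (f : E -> R) (w : F) : open O ->
  Ck k O f -> Ck k O (fun x => f x *: w).
Proof. by move=> oO Cf; apply: Ck_scale => //; exact: Ck_cst. Qed.

Lemma Ck_mx m n k O (f : E -> 'M[R]_(m, n)) : open O ->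
  (forall i j, Ck k O (fun x => f x i j)) -> Ck k O f.
Proof.
move=> oO Cf.
rewrite (_ : f = fun x => \sum_i \sum_j f x i j *: delta_mx i j); last first.
  by apply/funext => x; exact: matrix_sum_delta.
by do 2![apply: Ck_sum => // ?]; exact: Ck_scalel.
Qed.

(** The middle space is a matrix space so that the chain rule becomes a finite sum over basis
    directions: the derivative of [g \o f] along [v] is the sum of ['D_v f x i j] times
    ['D_(delta_mx i j) g \o f], and the induction hypothesis applies to each factor
    ['D_(delta_mx i j) g \o f]. *)
Lemma Ck_comp m n (F : normedModType R) k O O' (f : E -> 'M[R]_(m, n))
    (g : 'M[R]_(m, n) -> F) : open O ->
  (forall x, O x -> O' (f x)) -> Ck k O f -> Ck k O' g -> Ck k O (g \o f).
Proof.
move=> oO OO'; elim: k f g OO' => [|k IH] f g OO' Cf Cg;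
    have df := Ck_differentiable Cf; have dg := Ck_differentiable Cg.
  by split=> // x Ox; apply: differentiable_comp; [exact: df|exact/dg/OO'].
have dgf x : O x -> differentiable (g \o f) x.
  by move=> Ox; apply: differentiable_comp; [exact: df|exact/dg/OO'].
split=> // v.
have C1 : Ck k O (fun x => \sum_i \sum_j ('D_v f x i j) *: ('D_(delta_mx i j) g \o f) x).
  do 2![apply: Ck_sum => // ?]; apply: Ck_scale => //.
    exact/Ck_coord/(Cf.2 v).
  by apply: IH => //; [exact: Ck_succ|exact: Cg.2].
apply: (eq_Ck oO _ C1) => x Ox /=.
have dgx : differentiable g (f x) by exact/dg/OO'.
have dfx := df x Ox.
rewrite (deriveE v (dgf x Ox)) (diff_comp dfx dgx) /= -(deriveE v dfx).
rewrite [in RHS](matrix_sum_delta ('D_v f x)) linear_sum; apply: eq_bigr => i _.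
by rewrite linear_sum; apply: eq_bigr => j _; rewrite linearZ /= (deriveE _ dgx).
Qed.

Lemma Ck_pair (F G : normedModType R) k O (f : E -> F) (g : E -> G) : open O ->
  Ck k O f -> Ck k O g -> Ck k O (fun x => (f x, g x)).
Proof.
move=> oO; elim: k f g => [|k IH] f g Cf Cg; have df := Ck_differentiable Cf;
    have dg := Ck_differentiable Cg.
  by split=> // x Ox; apply: differentiable_pair; [exact: df|exact: dg].
have dp x : O x -> differentiable (fun x => (f x, g x)) x.
  by move=> Ox; apply: differentiable_pair; [exact: df|exact: dg].
split=> // v; apply: (eq_Ck oO _ (IH _ _ (Cf.2 v) (Cg.2 v))) => x Ox /=.
have dfx := df x Ox; have dgx := dg x Ox.
rewrite (deriveE v (dp x Ox)) (deriveE v dfx) (deriveE v dgx).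
by rewrite (diff_pair dfx dgx).
Qed.
End Operations.

Lemma pullback_comp (R : realType) (E F G : normedModType R) k (f : E -> F) (g : F -> G)
    (w : G -> ('I_k -> G) -> R) x v :
  differentiable f x -> differentiable g (f x) ->
  pullback (g \o f) w x v = pullback g w (f x) (fun i => 'D_(v i) f x).
Proof.
move=> df dg; rewrite /pullback; congr (w _ _); apply/funext => i.
rewrite (deriveE _ (differentiable_comp df dg)) (diff_comp df dg).
by rewrite (deriveE _ dg) (deriveE _ df).
Qed.

(** * Quaternionic polar coordinates *)

(* The matrix of v |-> conj(h) v acting on row vectors, h = (h0, h1, h2, h3). *)
Lemma det_left_mul_conj (R : realType) (h0 h1 h2 h3 : R) :
  \det (\matrix_(l < 4, j < 4)
    nth 0 (nth [::] [:: [:: h0; - h1; - h2; - h3];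
                        [:: h1; h0; - h3; h2];
                        [:: h2; h3; h0; - h1];
                        [:: h3; - h2; h1; h0]] l) j) =
  (h0 ^+ 2 + h1 ^+ 2 + h2 ^+ 2 + h3 ^+ 2) ^+ 2.
Proof.
rewrite (expand_det_row _ ord0) !big_ord_recl big_ord0 /cofactor.
rewrite !(expand_det_row _ ord0) !big_ord_recl !big_ord0 /cofactor.
rewrite !(expand_det_row _ ord0) !big_ord_recl !big_ord0 /cofactor.
rewrite !det_mx11 !mxE /=.
ring.
Qed.

(** Indices are written with [inord], as in [qmul], so that components match syntactically. *)
Lemma sum_ord4 (V : nmodType) (F : 'I_4 -> V) :
  \sum_i F i = F (inord 0) + F (inord 1) + F (inord 2) + F (inord 3).
Proof.
rewrite !big_ord_recl big_ord0 addr0 !addrA.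
by congr (F _ + F _ + F _ + F _); apply/val_inj; rewrite /= inordK.
Qed.

Lemma forall_ord4 (P : 'I_4 -> Prop) :
  P (inord 0) -> P (inord 1) -> P (inord 2) -> P (inord 3) -> forall j, P j.
Proof.
move=> P0 P1 P2 P3 j; rewrite -(inord_val j).
by case: j => [[|[|[|[|//]]]] ?].
Qed.

Lemma inord4_eq0 k : (k < 4)%N -> ((inord k : 'I_4) == ord0) = (k == 0)%N.
Proof. by move=> k4; rewrite -val_eqE /= inordK. Qed.

Lemma qnorm2E (R : realType) (q : 'rV[R]_4) : qnorm2 q =
  q 0 (inord 0) ^+ 2 + q 0 (inord 1) ^+ 2 + q 0 (inord 2) ^+ 2 + q 0 (inord 3) ^+ 2.
Proof. exact: sum_ord4. Qed.

Lemma qmul_qconjE (R : realType) (p q : 'rV[R]_4) :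
  let a j := p 0 (inord j) in
  let b j := q 0 (inord j) in
  qmul (qconj p) q = \row_(j < 4)
    [:: a 0%N * b 0%N + a 1%N * b 1%N + a 2%N * b 2%N + a 3%N * b 3%N;
        a 0%N * b 1%N - a 1%N * b 0%N - a 2%N * b 3%N + a 3%N * b 2%N;
        a 0%N * b 2%N + a 1%N * b 3%N - a 2%N * b 0%N - a 3%N * b 1%N;
        a 0%N * b 3%N - a 1%N * b 2%N + a 2%N * b 1%N - a 3%N * b 0%N]`_j.
Proof.
move=> a b; apply/rowP; apply: forall_ord4;
  rewrite /qmul /qconj !mxE !inord4_eq0 // !inordK //= /a /b; ring.
Qed.

(** With u = |q|^2, the linear forms on the left are d(|q|^4 / 4) and the imaginary components of
    q^-1 dq. They arise from the standard coordinates through [L *m D], where [L] is left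
    multiplication by the conjugate of q, of determinant u^2, and [D] = diag(u, u^-1, u^-1, u^-1)
    has determinant u^-2; the two cancel. *)
Lemma wedge_left_mul (R : realType) (q : 'rV[R]_4) (v : 'I_4 -> 'rV[R]_4) :
  qnorm2 q != 0 ->
  wedge (fun (j : 'I_4) (a : 'rV[R]_4) =>
    if j == ord0 then qnorm2 q * \sum_l q 0 l * a 0 l
    else (qnorm2 q)^-1 * qmul (qconj q) a 0 j) v =
  wedge (fun (j : 'I_4) (a : 'rV[R]_4) => a 0 j) v.
Proof.
move=> q0; set u := qnorm2 q in q0 *.
set D : 'M[R]_4 := diag_mx (\row_j (if j == ord0 then u else u^-1)).
set L : 'M[R]_4 := \matrix_(l < 4, j < 4)
    nth 0 (nth [::] (let h j := q 0 (inord j) in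
                    [:: [:: h 0%N; - h 1%N; - h 2%N; - h 3%N];
                        [:: h 1%N; h 0%N; - h 3%N; h 2%N];
                        [:: h 2%N; h 3%N; h 0%N; - h 1%N];
                        [:: h 3%N; - h 2%N; h 1%N; h 0%N]]) l) j.
rewrite [LHS](_ : _ = \det ((\matrix_(i, l) v i 0 l) *m (L *m D))).
  rewrite !det_mulmx det_diag det_left_mul_conj -qnorm2E -/u (bigD1 ord0) //= mxE eqxx.
  rewrite (eq_bigr (fun=> u^-1)); last by move=> j /negPf j0; rewrite mxE j0.
  rewrite prodr_const cardC1 card_ord exprVn /= -[RHS]mulr1 -mulrA.
  congr (_ * _); field.
  exact: q0.
congr (\det _); apply/matrixP => i j; rewrite mxE mulmxA mul_mx_diag [RHS]mxE [RHS]mulrC.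
by elim/forall_ord4: j; rewrite inord4_eq0 //= !mxE ?sum_ord4 !mxE !inord4_eq0 //=
  !inordK //=; congr (_ * _); ring.
Qed.

Lemma qnorm2_ge0 (R : realType) (q : 'rV[R]_4) : 0 <= qnorm2 q.
Proof. by apply: sumr_ge0 => j _; exact: sqr_ge0. Qed.

Lemma forall_gt0_open (R : realType) (T : topologicalType) n (f : 'I_n -> T -> R) :
  (forall k, continuous (f k)) -> open [set x | forall k, 0 < f k x].
Proof.
move=> cf; rewrite openE => x /= fx; apply: filter_forall => k.
exact: cvgr_gt (cf k x) _ (fx k).
Qed.

(** * The polar map, its inverse and its effect on the forms *)

Section PolarCoordinates.
Context {R : realType} {n : nat}.
Implicit Types (h : Hn R n) (z : 'rV[R]_n * Hn R n).

Definition rows_neq0 : set (Hn R n) :=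
  [set h : Hn R n | forall k, 0 < qnorm2 (row k h)].

Definition base_gt0 : set ('rV[R]_n * Hn R n) :=
  [set z : 'rV[R]_n * Hn R n | forall k, 0 < z.1 0 k].

(** [qnorm2] is a squared norm, so the exponent [- 2^-1] produces 1 / |h_k|. *)
Definition polar h : 'rV[R]_n * Hn R n :=
  (4^-1 *: pi_H h, \matrix_(k, j) (qnorm2 (row k h) `^ (- 2^-1) * h k j)).

(** The radius is recovered from xi = r^4 / 4 as r = (4 xi)^(1/4). *)
Definition polar_inv z : Hn R n :=
  \matrix_(k, j) ((4 * z.1 0 k) `^ 4^-1 * z.2 k j).

Lemma qnorm2_row k h : qnorm2 (row k h) = \sum_j h k j * h k j.
Proof. by apply: eq_bigr => j _; rewrite mxE expr2. Qed.

Lemma Ck_qnorm2_row m k (O : set (Hn R n)) :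
  open O -> Ck m O (fun h => qnorm2 (row k h)).
Proof.
move=> oO; rewrite (_ : (fun h => _) = fun h => \sum_j h k j * h k j); last first.
  by apply/funext => h; exact: qnorm2_row.
by apply: Ck_sum => // j; apply: Ck_mul => //; exact: Ck_entry.
Qed.

Lemma qnorm2_row_continuous k : continuous (fun h : Hn R n => qnorm2 (row k h)).
Proof.
move=> h; apply: differentiable_continuous.
exact: (Ck_differentiable (Ck_qnorm2_row 0 k (@openT (Hn R n)))).
Qed.

Lemma rows_neq0_open : open rows_neq0.
Proof. exact/forall_gt0_open/qnorm2_row_continuous. Qed.

Lemma base_gt0_open : open base_gt0.
Proof.
apply: (@forall_gt0_open R ('rV[R]_n * Hn R n)%type n (fun k z => z.1 0 k)) => k z.
apply: (@continuous_comp _ _ _ fst (fun x : 'rV[R]_n => x 0 k)); first exact: cvg_fst.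
exact: coord_continuous.
Qed.

Lemma smooth_polar : smooth rows_neq0 polar.
Proof.
have oO := rows_neq0_open.
apply/smoothP => k; apply: Ck_pair => //; apply: Ck_mx => // i j.
  rewrite (_ : (fun x => _) =
    fun h => 4^-1 * (qnorm2 (row j h) * qnorm2 (row j h))); last first.
    by apply/funext => h; rewrite !mxE expr2.
  apply: Ck_mul => //; first exact: Ck_cst.
  by apply: Ck_mul => //; exact: Ck_qnorm2_row.
rewrite (_ : (fun x => _) = fun h => qnorm2 (row i h) `^ (- 2^-1) * h i j); last first.
  by apply/funext => h; rewrite mxE.
apply: Ck_mul => //; last exact: Ck_entry.
by apply: Ck_powR => //; exact: Ck_qnorm2_row.
Qed.

Lemma smooth_polar_inv : smooth base_gt0 polar_inv.
Proof.
have oO := base_gt0_open.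
have cf : continuous (fst : 'rV[R]_n * Hn R n -> 'rV[R]_n) by move=> z; exact: cvg_fst.
have cs : continuous (snd : 'rV[R]_n * Hn R n -> Hn R n) by move=> z; exact: cvg_snd.
apply/smoothP => k; apply: Ck_mx => // i j.
rewrite (_ : (fun x => _) = fun z => (4 * z.1 0 i) `^ 4^-1 * z.2 i j); last first.
  by apply/funext => h; rewrite mxE.
apply: Ck_mul => //; last by apply: Ck_coord => //; exact: Ck_linear.
apply: Ck_powR => //; first by move=> z z0; rewrite mulr_gt0 //; exact: z0.
apply: Ck_mul => //; first exact: Ck_cst.
by apply: Ck_coord => //; exact: Ck_linear.
Qed.

Lemma powRN2_sqr (x : R) : 0 < x -> (x `^ (- 2^-1)) ^+ 2 = x^-1.
Proof.
move=> x0; rewrite -powR_mulrn ?powR_ge0// -powRrM mulNr mulVf// powR_inv1//.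
exact: ltW.
Qed.

Lemma powRV4_exp4 (x : R) : 0 <= x -> (x `^ 4^-1) ^+ 4 = x.
Proof. by move=> x0; rewrite -powR_mulrn ?powR_ge0// -powRrM mulVf// powRr1. Qed.

Lemma polar_Qn h : rows_neq0 h -> Qn (polar h).2.
Proof.
move=> h0 k; rewrite qnorm2_row /=.
under eq_bigr do rewrite !mxE mulrACA -expr2 powRN2_sqr ?h0//.
by rewrite -mulr_sumr -qnorm2_row mulVf// gt_eqF.
Qed.

Lemma qnorm2_polar_inv z k : base_gt0 z -> Qn z.2 ->
  qnorm2 (row k (polar_inv z)) = ((4 * z.1 0 k) `^ 4^-1) ^+ 2.
Proof.
move=> z0 /(_ k) z1; rewrite qnorm2_row.
under eq_bigr do rewrite !mxE mulrACA -expr2.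
by rewrite -mulr_sumr -qnorm2_row z1 mulr1.
Qed.

Lemma pi_H_polar_inv z : base_gt0 z -> Qn z.2 -> pi_H (polar_inv z) = 4 *: z.1.
Proof.
move=> z0 z1; apply/rowP => k; rewrite !mxE qnorm2_polar_inv// -exprM powRV4_exp4//.
by rewrite mulr_ge0// ltW//; exact: z0.
Qed.

Lemma rows_neq0_polar_inv z : base_gt0 z -> Qn z.2 -> rows_neq0 (polar_inv z).
Proof.
move=> z0 z1 k; rewrite qnorm2_polar_inv// exprn_gt0// powR_gt0// mulr_gt0//; exact: z0.
Qed.

Lemma polarK h : rows_neq0 h -> polar_inv (polar h) = h.
Proof.
move=> h0; apply/matrixP => k j; rewrite !mxE mulVKf ?pnatr_eq0// mulrA.
have u0 := h0 k; set u := qnorm2 (row k h) in u0 *.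
rewrite -{1}(powR_mulrn 2 (ltW u0)) -powRrM -powRD; last first.
  by apply/implyP => _; rewrite gt_eqF.
rewrite (_ : 2%:R * 4^-1 - 2^-1 = 0 :> R); last by field.
by rewrite powRr0 mul1r.
Qed.

Lemma polar_invK z : base_gt0 z -> Qn z.2 -> polar (polar_inv z) = z.
Proof.
move=> z0 z1; have x0 k : 0 < 4 * z.1 0 k by rewrite mulr_gt0//; exact: z0.
rewrite [RHS]surjective_pairing; congr (_, _).
  by rewrite pi_H_polar_inv// scalerA mulVf// scale1r.
apply/matrixP => k j; rewrite !mxE qnorm2_polar_inv//.
rewrite -[_ ^+ 2]powR_mulrn ?powR_ge0// -!powRrM mulrA -powRD; last first.
  by apply/implyP => _; rewrite gt_eqF.
rewrite (_ : 4^-1 * (2 * - 2^-1) + 4^-1 = 0 :> R); last by field.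
by rewrite powRr0 mul1r.
Qed.

Lemma base_gt0_polar h : rows_neq0 h -> base_gt0 (polar h).
Proof. by move=> h0 k; rewrite !mxE mulr_gt0// exprn_gt0//; exact: h0. Qed.

Lemma differentiable_qnorm2_row k h : differentiable (fun h => qnorm2 (row k h)) h.
Proof. exact: (Ck_differentiable (Ck_qnorm2_row 0 k (@openT (Hn R n)))). Qed.

Lemma derive_qnorm2_row h v k :
  'D_v (fun h => qnorm2 (row k h)) h = 2 * \sum_j h k j * v k j.
Proof.
rewrite (_ : (fun h => _) = \sum_j (fun h => h k j * h k j)); last first.
  by apply/funext => x; rewrite fct_sumE qnorm2_row.
have de j := @differentiable_coord R n 4 h k j.
rewrite derive_sum => [|j]; last first.
  exact/diff_derivable/(differentiable_scale (de j) (de j)).1.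
rewrite mulr_sumr; apply: eq_bigr => j _; rewrite derive_mul// derive_entry.
ring.
Qed.

(** The product rule for |h_k|^-1 h_k gives |h_k|^-1 v_k plus a multiple of h_k. The multiplier [c]
    stays unspecified because it drops out of the pullback. *)
Lemma derive_polar h v : rows_neq0 h ->
  (forall k, ('D_v polar h).1 0 k =
     qnorm2 (row k h) * \sum_j h k j * v k j) /\
  exists c : 'I_n -> R, forall k j, ('D_v polar h).2 k j =
     qnorm2 (row k h) `^ (- 2^-1) * v k j + c k * h k j.
Proof.
move=> h0; have oO := rows_neq0_open.
have /smoothP/(_ 0%N)/Ck_differentiable/(_ h0) dp := smooth_polar.
have d1 : differentiable (fun h => (polar h).1) h.
  apply: (@differentiable_comp _ _ _ _ polar fst) => //.
  by apply: linear_differentiable => x; exact: cvg_fst.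
have d2 : differentiable (fun h => (polar h).2) h.
  apply: (@differentiable_comp _ _ _ _ polar snd) => //.
  by apply: linear_differentiable => x; exact: cvg_snd.
have dE : 'D_v polar h = ('D_v (fun h => (polar h).1) h, 'D_v (fun h => (polar h).2) h).
  rewrite (deriveE v dp) (deriveE v d1) (deriveE v d2).
  have := diff_pair d1 d2.
  rewrite (_ : (fun y => _) = polar) => [->//|].
  by apply/funext => y; rewrite -surjective_pairing.
have dq k := differentiable_qnorm2_row k h.
rewrite dE; split=> [k|].
  rewrite (derive_mx (diff_derivable d1)) mxE.
  rewrite (_ : (fun h => _) =
    fun h => 4^-1 * (qnorm2 (row k h) * qnorm2 (row k h))); last first.
    by apply/funext => x; rewrite !mxE expr2.
  rewrite derive_mul //; last exact: (differentiable_scale (dq k) (dq k)).1.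
  rewrite derive_cst derive_mul// derive_qnorm2_row; by field.
exists (fun k => 'D_v (fun h => qnorm2 (row k h) `^ (- 2^-1)) h) => k j.
rewrite (derive_mx (diff_derivable d2)) mxE.
have -> : (fun h => (polar h).2 k j) = fun h => qnorm2 (row k h) `^ (- 2^-1) * h k j.
  by apply/funext => x; rewrite mxE.
rewrite derive_mul ?derive_entry//; last exact: differentiable_coord.
exact: (diff_powR _ (dq k) (h0 k)).1.
Qed.

(** By [derive_polar] each summand is the determinant of [wedge_left_mul] at the row h_k: one factor
    |h_k|^-1 comes from q_k and one from dq_k, together [(qnorm2 q)^-1]. *)
Lemma pullback_polar h v : rows_neq0 h -> pullback polar (@psi_RQ R n) h v = psi_H h v.
Proof.
move=> h0; apply: eq_bigr => k _.
have u0 := h0 k.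
transitivity
  (wedge (fun (j : 'I_4) (a : 'rV[R]_4) => a 0 j) (fun i => row k (v i))); last first.
  by congr (\det _); apply/matrixP => i j; rewrite !mxE.
rewrite -(@wedge_left_mul _ (row k h) (fun i => row k (v i))); last by rewrite gt_eqF.
congr (\det _); apply/matrixP => i j; rewrite [LHS]mxE [RHS]mxE.
have [D1 [c D2]] := derive_polar (v i) h0.
case: ifPn => [_|j0].
  by rewrite D1; congr (_ * _); apply: eq_bigr => l _; rewrite !mxE.
(* The radial part c_k h_k of dq_k does not contribute: conj(h_k) h_k is real. *)
have := powRN2_sqr u0; set w := _ `^ _ => <-.
move: j0; rewrite !qmul_qconjE; elim/forall_ord4: j; rewrite inord4_eq0 //= => _.
all: rewrite !mxE !inordK //= !D2 -/w; ring.
Qed.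

(** Ensures that fibers over the interior are nonempty. The witness has the quaternion 1 in every
    row. *)
Lemma Qn_nonempty : @Qn R n !=set0.
Proof.
exists (\matrix_(k, j) (j == ord0)%:R) => k; rewrite qnorm2_row.
rewrite (bigD1 ord0)//= big1 => [|j /negPf j0]; rewrite !mxE ?eqxx ?j0 ?mulr0//.
by rewrite mulr1 addr0.
Qed.

End PolarCoordinates.

(** * Charts and diffeomorphisms *)

Section SmoothWithin.
Context {R : realType}.

Lemma smooth_continuous (E F : normedModType R) (O : set E) (f : E -> F) x :
  smooth O f -> O x -> {for x, continuous f}.
Proof. by move=> sf Ox; apply: differentiable_continuous; exact: (sf [::]). Qed.

Lemma smoothW (E F : normedModType R) (O O' : set E) (f : E -> F) :
  O' `<=` O -> smooth O f -> smooth O' f.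
Proof. by move=> OO sf s x /OO; exact: sf. Qed.

Lemma open_setI_preimage (T U : topologicalType) (O : set T) (O' : set U) (f : T -> U) :
  open O -> (forall x, O x -> {for x, continuous f}) -> open O' ->
  open (O `&` f @^-1` O').
Proof.
rewrite !openE => oO cf oO' x [Ox O'fx]; apply: filterI; first exact: oO.
exact: cf x Ox _ (oO' _ O'fx).
Qed.

Lemma smooth_comp (E F : normedModType R) m n (O : set E) (O' : set 'M[R]_(m, n))
    (f : E -> 'M[R]_(m, n)) (g : 'M[R]_(m, n) -> F) :
  open O -> (forall x, O x -> O' (f x)) -> smooth O f -> smooth O' g ->
  smooth O (g \o f).
Proof.
move=> oO OO' /smoothP sf /smoothP sg; apply/smoothP => k.
exact: Ck_comp oO OO' (sf k) (sg k).
Qed.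

Lemma smooth_smooth_within (E F : normedModType R) (O X : set E) (f : E -> F) :
  open O -> X `<=` O -> smooth O f -> smooth_within X f.
Proof. by move=> oO XO sf x Xx; exists O, f; split => //; exact: XO. Qed.

Lemma smooth_withinW (E F : normedModType R) (X Y : set E) (f : E -> F) :
  Y `<=` X -> smooth_within X f -> smooth_within Y f.
Proof.
move=> YX sf x /YX /sf [ O [g [oO Ox sg fg]]]; exists O, g; split => // y Oy /YX Xy.
exact: fg.
Qed.

Lemma eq_smooth_within (E F : normedModType R) (X : set E) (f g : E -> F) :
  (forall x, X x -> f x = g x) -> smooth_within X f -> smooth_within X g.
Proof.
move=> fg sf x /sf [ O [h [oO Ox sh hf]]]; exists O, h; split => // y Oy Xy.
by rewrite hf// fg.
Qed.

(** The extension [f'] may leave the domain [O'] of the extension of [g], hence the restriction to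
    the preimage of [O']. *)
Lemma smooth_within_comp (E F : normedModType R) m n (X : set E)
    (Y : set 'M[R]_(m, n)) (f : E -> 'M[R]_(m, n)) (g : 'M[R]_(m, n) -> F) :
  (forall x, X x -> Y (f x)) -> smooth_within X f -> smooth_within Y g ->
  smooth_within X (g \o f).
Proof.
move=> XY sf sg x Xx; have [ O [f' [oO Ox sf' f'E]]] := sf x Xx.
have [ O' [g' [oO' O'fx sg' g'E]]] := sg _ (XY _ Xx).
have oOO' : open (O `&` f' @^-1` O').
  by apply: open_setI_preimage => // z Oz; exact: smooth_continuous Oz.
exists (O `&` f' @^-1` O'), (g' \o f'); split => //.
- by split => //=; rewrite f'E.
- apply: smooth_comp sg' => // [z []//|]; apply: smoothW sf'; exact: subIsetl.
- by move=> y [Oy O'y] Xy /=; rewrite f'E// g'E -?f'E// f'E//; exact: XY.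
Qed.

Lemma smooth_within_continuous (E F : normedModType R) (X : set E) (f : E -> F) :
  smooth_within X f -> {within X, continuous f}.
Proof.
move=> sf; apply/subspace_continuousP => x Xx.
have [ O [g [oO Ox sg gf]]] := sf x Xx.
have gx : g @ within X (nbhs x) --> f x.
  rewrite -(gf x Ox Xx); apply: cvg_trans (smooth_continuous sg Ox).
  exact/cvg_app/cvg_within.
apply: cvg_trans gx; apply: near_eq_cvg.
rewrite near_withinE; apply: filterS (open_nbhs_nbhs (conj oO Ox)) => y Oy Xy.
exact: gf.
Qed.

Lemma smooth_within_near_differentiable (E F : normedModType R) (X : set E)
    (f : E -> F) x : smooth_within X f -> nbhs x X -> differentiable f x.
Proof.
move=> sf nX; have [ O [g [oO Ox sg gf]]] := sf x (nbhs_singleton nX).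
apply: near_eq_differentiable (sg [::] x Ox) => /=.
by apply: filterS2 nX (open_nbhs_nbhs (conj oO Ox)) => y Xy Oy; exact: gf.
Qed.
End SmoothWithin.

(** * Charts and diffeomorphisms onto subsets of vector spaces *)

Section Charts.
Context {R : realType} {E : normedModType R} {X : set E}.

Lemma chart_cmap_continuous (T : topologicalType) (c : chart T E) p :
  is_chart X c -> cdom c p -> {for p, continuous (cmap c)}.
Proof.
case=> oc _ _ cc _ cp; move: cc; rewrite continuous_open_subspace// => /(_ p).
by apply; rewrite inE.
Qed.

(** Charts send open sets to relatively open subsets of [X]. The [near] form yields a full
    neighbourhood as soon as [X] is one, as for [X = setT] or at a positive point of the orthant. *)
Lemma chart_near (T : topologicalType) (c : chart T E) (A : set T) p :
  is_chart X c -> open A -> A p -> cdom c p ->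
  \forall y \near cmap c p, X y -> (cmap c @` (A `&` cdom c)) y.
Proof.
case=> oc [ O oO cO] cK _ ci oA Ap cp.
have cic : cimg c (cmap c p) by exists p.
have nA : nbhs (cinv c (cmap c p)) A by rewrite cK//; exact: open_nbhs_nbhs.
move/subspace_continuousP/(_ _ cic)/(_ _ nA) : ci => ciA.
have {}ciA : \forall y \near cmap c p, cimg c y -> A (cinv c y) := ciA.
have Op : O (cmap c p) by move: cic; rewrite cO => -[].
apply: filterS2 ciA (open_nbhs_nbhs (conj oO Op)) => y yA Oy Xy.
have cy : cimg c y by rewrite cO.
by have := yA cy; case: cy => q cq <- /=; rewrite cK// => Aq; exists q.
Qed.

Context (N : manifold X).

Lemma atlas_chart (c : chart N E) : atlas c -> is_chart X c.
Proof. by case: N c => ? ? ? ? + ? ?; exact. Qed.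

Lemma atlas_cover (p : N) : exists2 c : chart N E, atlas c & cdom c p.
Proof. by case: N p => ? ? ? ? ? + ?; exact. Qed.

(** [diffeomorphism] states smoothness of [f] only in charts; near [p] the map factors as a smooth
    extension after the continuous [cmap c]. *)
Lemma diffeomorphism_continuous (F : normedModType R) (W : set N) (S : set F)
    (f : N -> F) p : diffeomorphism W S f -> W p -> {for p, continuous f}.
Proof.
move=> [oW _ sf _] Wp; have [c ac cp] := atlas_cover p.
have cc := atlas_chart ac; have [oc _ cK _ _] := cc.
have Wc : (cmap c @` (W `&` cdom c)) (cmap c p) by exists p.
have [ O [g [oO Ox sg gf]]] := sf _ ac _ Wc.
have cfor := chart_cmap_continuous cc cp.
have gE q : W q -> cdom c q -> O (cmap c q) -> f q = g (cmap c q).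
  by move=> Wq cq Oq; rewrite gf ?cK//=; [rewrite cK|exists q].
have gc : (g \o cmap c) @ p --> f p.
  rewrite gE//; apply: (@continuous_comp _ _ _ (cmap c) g) => //.
  exact: smooth_continuous Ox.
apply: cvg_trans gc; apply: near_eq_cvg.
have nO : \forall q \near p, O (cmap c q) := cfor _ (open_nbhs_nbhs (conj oO Ox)).
have nW := open_nbhs_nbhs (conj oW Wp).
have nc := open_nbhs_nbhs (conj oc cp).
by apply: filterS3 nO nW nc => q Oq Wq cq; rewrite /= gE.
Qed.

(** Serves twice: for [polar] after a toric chart on the total space, and for the scaling by 1/4
    after the chart of the base. *)
Lemma diffeomorphism_comp (F : normedModType R) m n (W W' : set N)
    (S : set 'M[R]_(m, n)) (S' : set F) (f : N -> 'M[R]_(m, n))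
    (T : 'M[R]_(m, n) -> F) (T' : F -> 'M[R]_(m, n)) :
  diffeomorphism W S f -> open W' -> W' `<=` W ->
  smooth_within (f @` W') T -> smooth_within S' T' ->
  (forall p, W' p -> S' (T (f p)) /\ T' (T (f p)) = f p) ->
  (forall z, S' z -> (f @` W') (T' z) /\ T (T' z) = z) ->
  diffeomorphism W' S' (T \o f).
Proof.
move=> [oW [fS fI fsurj] sf [g [gK cg sg]]] oW' WW sT sT' TP T'P.
have S'S z : S' z -> S (T' z).
  by move=> /T'P[[p W'p <-] _]; apply: fS; exact: WW.
split => //.
- split.
  + by move=> p /TP[].
  + move=> p q; rewrite !inE => W'p W'q /= eTf; apply: fI; rewrite ?inE; try exact: WW.
    by have [_ <-] := TP _ W'p; have [_ <-] := TP _ W'q; rewrite eTf.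
  + by move=> z /T'P[[p W'p fp] Tz]; exists p => //=; rewrite fp.
- move=> c ac; have [_ _ cK _ _] := atlas_chart ac.
  apply: (@smooth_within_comp _ _ _ _ _ _ (f @` W') (f \o cinv c)) => //.
    by move=> _ [p [W'p cp] <-]; exists p => //=; rewrite cK.
  apply: smooth_withinW (sf _ ac) => _ [p [W'p cp] <-]; exists p => //.
  by split => //; exact: WW.
- exists (g \o T'); split.
  + by move=> p W'p /=; have [_ ->] := TP _ W'p; rewrite gK//; exact: WW.
  + move/subspace_continuousP : cg => cg; apply/subspace_continuousP => z S'z.
    have /subspace_continuousP/(_ _ S'z) cT' := smooth_within_continuous sT'.
    (* The ascribed types unfold the [within] filters into implications, whose premise on [T'] is
       discharged by [S'S]. *)
    move=> A nA; have cgA : \forall y \near T' z, S y -> A (g y) := cg _ (S'S _ S'z) A nA.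
    have cgT : \forall y \near z, S' y -> S (T' y) -> A (g (T' y)) := cT' _ cgA.
    suff : \forall y \near z, S' y -> A (g (T' y)) by [].
    by apply: filterS cgT => y yA S'y; apply: yA => //; exact: S'S.
  + move=> c ac; apply: (@smooth_within_comp _ _ _ _ _ _ _ T') (sg _ ac).
      by move=> z [S'z cz]; split => //; exact: S'S.
    by apply: smooth_withinW sT' => z [].
Qed.

(** The two transition conditions of [smooth_chart] are the smoothness of [cmap c] and of
    [cinv c]. *)
Lemma smooth_chart_diffeomorphism (c : chart N E) : smooth_chart c ->
  diffeomorphism (cdom c) (cimg c) (cmap c).
Proof.
move=> [[oc cO cK cc ci] tc]; split => //.
- split => [p cp|p q|]; first by exists p.
    by rewrite !inE => cp cq eqc; rewrite -(cK p)// eqc cK.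
  by move=> _ [p cp <-]; exists p.
- by move=> c' /tc[_]; rewrite /smooth_transition setIC.
- exists (cinv c); split => // c' /tc[+ _]; apply: smooth_withinW.
  by move=> _ [[p cp <-]]; rewrite /preimage/= cK// => c'p; exists p.
Qed.

End Charts.

(** * Invariance of interior points under changes of charts *)

Section InteriorInvariance.
Context {R : realType}.

(** The derivative is also the limit of the difference quotients from the right, and these are
    nonnegative. *)
Lemma derive_ge0_of_min (E : normedModType R) (f : E -> R) x v :
  differentiable f x -> f x = 0 -> (\forall y \near x, 0 <= f y) -> 0 <= 'D_v f x.
Proof.
move=> df fx0 f0; have dv : derivable f x v by exact: diff_derivable.
rewrite /derive cvg_at_rightE//; apply: limr_ge.
  apply/cvg_ex; have /cvg_ex[l dvl] := dv; exists l; apply: cvg_trans dvl.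
  apply: cvg_app => A nA; have {}nA : \forall t \near (0 : R), t != 0 -> A t := nA.
  suff : \forall t \near (0 : R), 0 < t -> A t by [].
  by apply: filterS nA => t At t0; apply: At; rewrite gt_eqF.
have cx : (h *: v + x) @[h --> (0 : R)] --> x.
  rewrite -[X in _ --> X]add0r -(scale0r v).
  by apply: cvgD; [exact: scalel_continuous|exact: cvg_cst].
have f0v : \forall h \near (0 : R), 0 <= f (h *: v + x) := cx _ f0.
suff : \forall h \near (0 : R), 0 < h -> 0 <= h^-1 *: (f (h *: v + x) - f x) by [].
apply: filterS f0v => h fh h0; rewrite fx0 subr0.
by apply: mulr_ge0 => //; rewrite invr_ge0 ltW.
Qed.

(** The previous bound, applied to both [v] and [- v]. *)
Lemma derive_eq0_of_min (E : normedModType R) (f : E -> R) x v :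
  differentiable f x -> f x = 0 -> (\forall y \near x, 0 <= f y) -> 'D_v f x = 0.
Proof.
move=> df fx0 f0; apply/eqP; rewrite eq_le -oppr_ge0 (deriveE v df) -linearN.
by rewrite -!(deriveE _ df) !derive_ge0_of_min.
Qed.

(** The chain rule makes the differential of [g] a left inverse of that of [f]; between spaces of
    equal dimension it is two-sided ([mulmx1C]), so the image of [w] under it is a preimage of
    [w]. *)
Lemma differentiable_left_inverse_surj n (f g : 'rV[R]_n -> 'rV[R]_n) x :
  differentiable f x -> differentiable g (f x) -> (\forall y \near x, g (f y) = y) ->
  forall w, exists v, 'd f x v = w.
Proof.
move=> df dg gfK w.
have gfE v : 'd g (f x) ('d f x v) = v.
  rewrite -[LHS]/(('d g (f x) \o 'd f x) v) -(diff_comp df dg).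
  rewrite -(deriveE v (differentiable_comp df dg)).
  by rewrite (near_eq_derive v gfK) derive_id.
have AB : lin1_mx ('d f x) *m lin1_mx ('d g (f x)) = 1%:M.
  by apply/row_matrixP => i; rewrite !rowE mulmxA !mul_rV_lin1 /= gfE mulmx1.
exists (w *m lin1_mx ('d g (f x))).
by rewrite -(mul_rV_lin1 ('d f x)) -mulmxA (mulmx1C AB) mulmx1.
Qed.

Lemma orthant_near n (x : 'rV[R]_n) : (forall k, 0 < x 0 k) ->
  \forall y \near x, @orthant R n y.
Proof.
move=> x0; have oP : open [set y : 'rV[R]_n | forall k, 0 < y 0 k].
  by apply: forall_gt0_open => k; exact: coord_continuous.
by apply: filterS (open_nbhs_nbhs (conj oP x0)) => y y0 k; exact: ltW.
Qed.

(** [smooth_chart] compares only with charts of the atlas, so two such charts are compared through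
    an atlas chart [c''], on its domain. *)
Lemma smooth_within_transition n (X : set 'rV[R]_n) (N : manifold X)
    (c c' c'' : chart N 'rV[R]_n) :
  smooth_chart c -> smooth_chart c' -> atlas c'' ->
  smooth_within (cmap c @` (cdom c `&` cdom c' `&` cdom c'')) (cmap c' \o cinv c).
Proof.
move=> [[_ _ cK _ _] tc] [_ tc'] ac''; have [_ _ cK'' _ _] := atlas_chart ac''.
have s1 := (tc _ ac'').1; have s2 := (tc' _ ac'').2.
apply: (@eq_smooth_within _ _ _ _ ((cmap c' \o cinv c'') \o (cmap c'' \o cinv c))).
  by move=> _ [p [[cp c'p] c''p] <-] /=; rewrite cK// cK''.
apply: smooth_within_comp s2.
  by move=> _ [p [[cp c'p] c''p] <-] /=; rewrite cK//; exists p.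
by apply: smooth_withinW s1 => _ [p [[cp c'p] c''p] <-]; exists p.
Qed.

(** [interior_point] provides positivity in some chart only; this carries it over to the toric
    chart. *)
Lemma interior_chart_gt0 n (N : manifold (@orthant R n)) (c c' : chart N 'rV[R]_n) p :
  smooth_chart c -> smooth_chart c' -> cdom c p -> cdom c' p ->
  (forall k, 0 < cmap c p 0 k) -> forall k, 0 < cmap c' p 0 k.
Proof.
move=> sc sc' cp c'p x0 k; have [c'' ac'' c''p] := atlas_cover p.
have [cc _] := sc; have [cc' _] := sc'; have cc'' := atlas_chart ac''.
have [oc _ cK _ _] := cc; have [oc' [ O oO cO] cK' _ _] := cc'.
have [oc'' _ _ _ _] := cc''.
set A := cdom c `&` cdom c' `&` cdom c''.
have oA : open A by do 2!apply: openI => //.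
have Ap : A p by [].
have s1 : smooth_within (cmap c @` A) (cmap c' \o cinv c).
  exact: smooth_within_transition.
have s2 : smooth_within (cmap c' @` A) (cmap c \o cinv c').
  by rewrite /A [cdom c `&` _]setIC; exact: smooth_within_transition.
(* Positivity in [c] places [cmap c p] inside the orthant, so [F] is defined on a full neighbourhood
   and has a differential there. *)
have nA : nbhs (cmap c p) (cmap c @` A).
  apply: filterS2 (chart_near cc oA Ap cp) (orthant_near x0) => y /[apply].
  by move=> [q [Aq _] <-]; exists q.
set F := cmap c' \o cinv c in s1.
have dF : differentiable F (cmap c p) by exact: smooth_within_near_differentiable nA.
have FE : F (cmap c p) = cmap c' p by rewrite /F /= cK.
(* On the side of [c'] the point might still lie on the boundary, so the inverse transition is
   differentiated through a local extension [G]. *)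
have [U [G [oU Up sG GE]]] : exists (U : set 'rV[R]_n) (g : 'rV[R]_n -> 'rV[R]_n),
    [/\ open U, U (cmap c' p), smooth U g &
     forall y, U y -> (cmap c' @` A) y -> g y = (cmap c \o cinv c') y].
  by apply: s2; exists p.
have dG : differentiable G (F (cmap c p)) by rewrite FE; exact: (sG [::]).
have GF : \forall y \near cmap c p, G (F y) = y.
  have nU : \forall y \near cmap c p, U (F y).
    apply: (differentiable_continuous dF); rewrite FE.
    exact: open_nbhs_nbhs.
  apply: filterS2 nU nA => y + [q [[cq c'q] c''q] qy]; rewrite -qy /F /= cK// => Uq.
  by rewrite GE//=; [rewrite cK'|exists q].
have Fge0 : \forall y \near cmap c p, 0 <= F y 0 k.
  apply: filterS nA => _ [q [[cq c'q] c''q] <-]; rewrite /F /= cK//.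
  have : cimg c' (cmap c' q) by exists q.
  by rewrite cO => -[_]; exact.
have Fkge0 : 0 <= cmap c' p 0 k by rewrite -FE; exact: nbhs_singleton Fge0.
rewrite lt_neqAle Fkge0 andbT; apply/eqP => Fk0.
have dFk : differentiable (fun y => F y 0 k) (cmap c p).
  apply: (@differentiable_comp _ _ _ _ F (fun y : 'rV[R]_n => y 0 k)) => //.
  exact: differentiable_coord.
(* Along this [v] the k-th coordinate of [F] has derivative 1, whereas a minimum forces 0. *)
have [v vE] := differentiable_left_inverse_surj dF dG GF (delta_mx 0 k).
have := derive_eq0_of_min v dFk _ Fge0; rewrite FE => /(_ (esym Fk0)).
have := derive_mx (diff_derivable (v := v) dF); rewrite (deriveE v dF) vE.
move=> /matrixP/(_ 0 k); rewrite !mxE !eqxx /= => <- /eqP; rewrite oner_eq0.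
by [].
Qed.
End InteriorInvariance.

(** * Action-angle coordinates over the interior *)

Section ActionAngle.
Context {R : realType} {n : nat} {M : manifold [set: Hn R n]} {psi : diff_form M 4}.
Context {B : manifold (@orthant R n)} {proj : M -> B}.
Context {phi : chart B 'rV[R]_n} {Phi : M -> Hn R n}.
Context (sphi : smooth_chart phi).
Context (tPhi : tetraplectomorphism psi (proj @^-1` cdom phi)
  (@pi_H R n @^-1` cimg phi) (@psi_H R n) Phi).
Context (projPhi : forall p, cdom phi (proj p) -> pi_H (Phi p) = cmap phi (proj p)).

Definition inner_base : set B := cdom phi `&` [set b | forall k, 0 < cmap phi b 0 k].
Definition inner_total : set M := proj @^-1` inner_base.
(** The factor 4 undoes the [4^-1] in [polar]: xi is a quarter of the toric coordinate of the
    base. *)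
Definition inner_image : set 'rV[R]_n :=
  [set x : 'rV[R]_n | (forall k, 0 < x 0 k) /\ cimg phi (4 *: x)].

Let F := polar \o Phi.
Let h := (fun x : 'rV[R]_n => 4^-1 *: x) \o cmap phi.

Lemma rows_neq0_inner p : inner_total p -> rows_neq0 (Phi p).
Proof.
move=> [cp gp] k; have := gp k; rewrite -projPhi// mxE => u0.
rewrite lt_neqAle qnorm2_ge0 andbT; apply: contraTneq u0 => <-.
by rewrite expr0n /= ltxx.
Qed.

(** Turns the condition on the base into one on [Phi], so that openness follows from the continuity
    of [Phi]; continuity of [proj] is not among the hypotheses. *)
Lemma inner_totalE : inner_total = (proj @^-1` cdom phi) `&` Phi @^-1` rows_neq0.
Proof.
apply/seteqP; split=> [p Wp|p [cp r0]]; first by split; [case: Wp|exact: rows_neq0_inner].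
by split=> // k; rewrite -projPhi// mxE exprn_gt0//; exact: r0.
Qed.

Lemma inner_total_open : open inner_total.
Proof.
have [dPhi _] := tPhi; have [oW _ _ _] := dPhi.
rewrite inner_totalE; apply: open_setI_preimage oW _ rows_neq0_open => p.
exact: diffeomorphism_continuous dPhi.
Qed.

Lemma inner_base_open : open inner_base.
Proof.
have [[oc _ _ _ _] _] := sphi; have dphi := smooth_chart_diffeomorphism sphi.
apply: (@open_setI_preimage _ _ _ [set x : 'rV[R]_n | forall k, 0 < x 0 k] (cmap phi) oc).
  by move=> p; exact: diffeomorphism_continuous dphi.
by apply: forall_gt0_open => k; exact: coord_continuous.
Qed.

Lemma inner_image_open : open inner_image.
Proof.
have [[_ [ O oO cO] _ _ _] _] := sphi.
(* At strictly positive points membership in the orthant is automatic, so a relatively open image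
   becomes an open condition. *)
rewrite (_ : inner_image =
    [set x : 'rV[R]_n | forall k, 0 < x 0 k] `&` (fun x : 'rV[R]_n => 4 *: x) @^-1` O).
  apply: open_setI_preimage oO; last by move=> x _; exact: scaler_continuous.
  by apply: forall_gt0_open => k; exact: coord_continuous.
apply/seteqP; split=> x [x0]; first by rewrite cO => -[]; split.
by move=> Ox; split; rewrite // cO; split=> // k; rewrite mxE mulr_ge0// ltW.
Qed.

Lemma polar_inner_image p : inner_total p -> (inner_image `*` @Qn R n) (polar (Phi p)).
Proof.
move=> Wp; have r0 := rows_neq0_inner Wp; split; last exact: polar_Qn.
split; first exact: base_gt0_polar.
rewrite /= scalerA mulfV// scale1r projPhi; last by case: Wp.
by case: Wp => cp _; exists (proj p).
Qed.

Lemma polar_inv_inner z : (inner_image `*` @Qn R n) z ->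
  exists2 p, inner_total p & Phi p = polar_inv z.
Proof.
move=> [[z0 cz] z1]; have [[_ [_ _ surj] _ _] _] := tPhi.
have [|p cp pE] := surj (polar_inv z); first by rewrite /= pi_H_polar_inv.
exists p => //; rewrite inner_totalE; split => //.
by rewrite /= pE; exact: rows_neq0_polar_inv.
Qed.

Lemma inner_diffeomorphism : diffeomorphism inner_total (inner_image `*` @Qn R n) F.
Proof.
have [dPhi _] := tPhi.
apply: (diffeomorphism_comp (T' := polar_inv) dPhi).
- exact: inner_total_open.
- by move=> p [].
- apply: smooth_smooth_within smooth_polar; first exact: rows_neq0_open.
  by move=> _ [p Wp <-]; exact: rows_neq0_inner.
- apply: smooth_smooth_within smooth_polar_inv; first exact: base_gt0_open.
  by move=> z [[]].
- move=> p Wp; split; first exact: polar_inner_image.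
  exact/polarK/rows_neq0_inner.
- move=> z Vz; split; first by have [p Wp <-] := polar_inv_inner Vz; exists p.
  by case: Vz => -[z0 _] z1; exact: polar_invK.
Qed.

Lemma inner_tetraplectomorphism :
  tetraplectomorphism psi inner_total (inner_image `*` @Qn R n) (@psi_RQ R n) F.
Proof.
have [dPhi psiPhi] := tPhi; have [oW _ sPhi _] := dPhi.
split; first exact: inner_diffeomorphism.
move=> c p v ac Wp cp; have cc := atlas_chart ac; have [_ _ cK _ _] := cc.
have Wp0 : (proj @^-1` cdom phi) p by case: Wp.
have GE : (Phi \o cinv c) (cmap c p) = Phi p by rewrite /= cK.
have dG : differentiable (Phi \o cinv c) (cmap c p).
  apply: smooth_within_near_differentiable (sPhi _ ac) _.
  (* The model set is [setT], so the chart image is a full neighbourhood. *)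
  by apply: filterS (chart_near cc oW Wp0 cp) => y; exact.
have r0 := rows_neq0_inner Wp.
have dp : differentiable (@polar R n) ((Phi \o cinv c) (cmap c p)).
  by rewrite GE; exact: (smooth_polar [::]).
rewrite -psiPhi// -[F \o cinv c]/(polar \o (Phi \o cinv c)) (pullback_comp _ _ dG dp).
by rewrite pullback_polar// GE.
Qed.

Lemma inner_fiber b : inner_base b ->
  F @` (inner_total `&` proj @^-1` [set b]) = [set h b] `*` @Qn R n.
Proof.
move=> [cb b0]; have [[_ _ cK _ _] _] := sphi; apply/seteqP; split.
  move=> _ [p [Wp pb] <-]; have [_ ?] := polar_inner_image Wp; split => //.
  by rewrite /F /= projPhi; [rewrite pb|case: Wp].
move=> z [zh z1].
have zE : 4 *: z.1 = cmap phi b by rewrite zh /h /= scalerA mulfV// scale1r.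
have Vz : (inner_image `*` @Qn R n) z.
  split => //; split; last by rewrite zE; exists b.
  by move=> k; rewrite zh mxE mulr_gt0.
have [p Wp pE] := polar_inv_inner Vz; have [[z0 _] _] := Vz.
exists p; last by rewrite /F /= pE polar_invK.
split => //; have [cp _] := Wp.
(* [proj p] and [b] have the same coordinates in [phi], hence are equal. *)
by rewrite /= -(cK _ cp) -projPhi// pE pi_H_polar_inv// zE cK.
Qed.

(** Surjectivity holds because, by [inner_fiber], each fiber is carried onto a nonempty copy of
    Q^n. *)
Lemma inner_total_image : proj @` inner_total = inner_base.
Proof.
apply/seteqP; split=> [_ [p Wp <-]//|b ib].
have [q Qq] := @Qn_nonempty R n.
have : ([set h b] `*` @Qn R n) (h b, q) by [].
by rewrite -(inner_fiber ib) => -[p [Wp pb] _]; exists p.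
Qed.

Lemma inner_base_diffeomorphism : diffeomorphism inner_base inner_image h.
Proof.
have dphi := smooth_chart_diffeomorphism sphi; have [[_ _ cK _ _] _] := sphi.
have smZ (a : R) X : smooth_within X (fun x : 'rV[R]_n => a *: x).
  apply: (@smooth_smooth_within _ _ _ setT) => //; first exact: openT.
  apply/smoothP => k; apply: (@Ck_linear _ _ _ _ _ ( *:%R a : {linear _ -> _})).
  exact: scaler_continuous.
apply: (diffeomorphism_comp (T' := fun x => 4 *: x) dphi) => //.
- exact: inner_base_open.
- by move=> b [].
- move=> b [cb b0]; rewrite scalerA mulfV// scale1r; split => //; split.
    by move=> k; rewrite mxE mulr_gt0.
  by rewrite scalerA mulfV// scale1r; exists b.
- move=> x [x0 [b cb bx]]; rewrite scalerA mulVf// scale1r; split => //.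
  by exists b => //; split => // k; rewrite bx mxE mulr_gt0.
Qed.

Lemma inner_fiber_preserving :
  fiber_preserving_tetraplectomorphism psi proj inner_total inner_image F.
Proof.
split; first exact: inner_tetraplectomorphism.
exists h; rewrite inner_total_image; first exact: inner_base_diffeomorphism.
exact: inner_fiber.
Qed.

End ActionAngle.

Theorem mainTheorem3 (R : realType) (n : nat)
    (M : manifold [set: Hn R n]) (psi : diff_form M 4)
    (B : manifold (@orthant R n)) (pi : M -> B)
    (hpsi : tetraplectic psi)
    (hpi : locally_toric_fibration psi pi)
    (b : B) (hb : interior_point b) :
  exists (W : set M) (V : set 'rV[R]_n) (f : M -> 'rV[R]_n * Hn R n),
    [/\ open W, pi @^-1` [set b] `<=` W, open V &
        fiber_preserving_tetraplectomorphism psi pi W V f].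
Proof.
have [I [phiB [phiM [sphi cover tphi]]]] := hpi; have [c [sc cb c0]] := hb.
(* The toric chart [phiB a] is unrelated to the chart [c] that witnesses interiority;
   [interior_chart_gt0] links them below. *)
have [a ab] := cover b; have [tPhi piPhi] := tphi a.
exists (inner_total (proj := pi) (phi := phiB a)), (inner_image (phi := phiB a)).
exists (polar \o phiM a).
split.
- exact: inner_total_open tPhi piPhi.
- move=> p pb; rewrite /inner_total /preimage /= (pb : pi p = b).
  by split => //; exact: interior_chart_gt0 sc (sphi a) cb ab c0.
- exact: inner_image_open.
- exact: inner_fiber_preserving.
Qed.
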